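(* Consider the iterative negotiation and oversight framework described in the context. Let $u=\frac1n\mathbf{1}^n$, $J_{\mathrm{sys}}(o)=\sum_{i=1}^n J_i^{\mathrm{ind}}(o)=nS_u(o)$, $o^{\mathrm{opt}}\in\arg\min_{o\in\mathcal{O}}J_{\mathrm{sys}}(o)$, and $\delta_r:=\|\bar{\mathbf{w}}^{(r)}-u\|_1$. Let $\eta_r:=S_{\bar{\mathbf{w}}^{(r)}}(o_r^{\mathrm{TACo}})-S_{\bar{\mathbf{w}}^{(r)}}(o^\dagger)$ with $o^\dagger\in\arg\min_{o\in\mathcal{O}}S_{\bar{\mathbf{w}}^{(r)}}(o)$. Then $$0 \le J_{\mathrm{sys}}\big(o_r^{\mathrm{TACo}}\big)-J_{\mathrm{sys}}(o^{\mathrm{opt}})\le n \left( B_{\max}\,\delta_r + \eta_r \right)\le n \left( B_{\max}\,\delta_r + \frac{B_{\max}}{\alpha_r} \right).$$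
   Context: Agents and costs. $\mathbf{N}=\{1,\dots,n\}$ is the set of agents and $\mathcal{O}$ is a finite set of feasible choices. Agent $i$ has an individual (intrinsic) cost $J_i^{\mathrm{ind}}:\mathcal{O}\to\mathbb{R}$, and $J^{\mathrm{ind}}(o)=[J_1^{\mathrm{ind}}(o),\dots,J_n^{\mathrm{ind}}(o)]^\top$. Agent $i$ has an asset reserve $R_i>0$; $\kappa>0$ is a tax parameter; agent $i$'s valuation of one unit of the traded asset is $b_i=1/(\kappa R_i)$. Put $B_i:=\max_{o,o'\in\mathcal{O}}|J_i^{\mathrm{ind}}(o)-J_i^{\mathrm{ind}}(o')|$ and $B_{\max}:=\max_i B_i$. $\mathbf{1}^n$ is the all-ones vector in $\mathbb{R}^n$. Rounds. Rounds are indexed $r=1,2,\dots$, with coordination factor $\mathbf{w}^{(r)}\in\mathbb{R}^n_{\ge0}$, $\mathbf{w}^{(1)}=0$. Put $\alpha_r:=\|\mathbf{w}^{(r)}\|_1+1$, $\bar{\mathbf{w}}^{(r)}:=\mathbf{w}^{(r)}/\alpha_r$, $S_v(o):=v^\top J^{\mathrm{ind}}(o)$ for $v\in\mathbb{R}^n$, and define the effective cost $J_i^{\mathbf{w}^{(r)}}(o):=S_{\bar{\mathbf{w}}^{(r)}}(o)+\frac{1}{\alpha_r}J_i^{\mathrm{ind}}(o)$. In round $r$: (1) each agent $i$ generates $o_i^{(r)}\in\arg\min_{o\in\mathcal{O}}J_i^{\mathbf{w}^{(r)}}(o)$, and $\mathcal{O}^{(r)}=\{o_1^{(r)},\dots,o_n^{(r)}\}$;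 (2) the agents run TACo (below) on $\mathcal{O}^{(r)}$ with costs given by the effective costs, yielding the agreed outcome $o_r^{\mathrm{TACo}}\in\mathcal{O}^{(r)}$, payments $P_i$ and offers $O_i$ (in asset units, for the agreed outcome); (3) with $e_i=P_i-O_i$ and shortfall $s_i=\frac{1}{R_i}\max\{0,e_i-R_i\}$, the process terminates if $\sum_i s_i=0$; (4) otherwise $\mathbf{w}^{(r+1)}=\mathbf{w}^{(r)}+\bar s$ with $\bar s_i=s_i/\sum_j s_j$. Hence $\alpha_{r+1}=\alpha_r+1$. TACo (trading auction for consensus). Each agent $i$ has cost $C_{i\ell}$ for option $\ell$, and offer and payment units $O_{i\ell},P_{i\ell}\ge0$, initially zero. Agent $i$'s profit is $b_i(O_{i\ell}-P_{i\ell})-C_{i\ell}$. Agents take turns; the agent $i$ in turn selects a profit-maximizing option $\ell_i^*$, whereupon $P_{i\ell_i^*}$ increases by $nd$ and $O_{j\ell_i^*}$ increases by $d$ for every agent $j$, where $d>0$ is the current trading unit. When a cycle is detected (an agent's profits repeat at two different steps), $d$ is replaced by $\gamma d$ with fixed $\gamma\in(0,1)$. The procedure ends when all agents choose the same option or the profit gap among all options in a cycle falls below a tolerance $\varepsilon>0$, at which point a consensus is declared. *)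

(* Defs.v *)
From mathcomp Require Import all_boot all_order all_algebra.
From mathcomp Require Import reals.

Set Implicit Arguments.
Unset Strict Implicit.
Unset Printing Implicit Defensive.

Import Order.TTheory GRing.Theory Num.Theory.
Local Open Scope ring_scope.

Section Framework.
Variables (R : realType) (n : nat) (O : finType).

Definition argmin (f : O -> R) : {set O} :=
  [set o | [forall o', f o <= f o']].

Definition argmax_in (A : {set O}) (f : O -> R) : {set O} :=
  [set o in A | [forall o' in A, f o' <= f o]].

Definition l1norm (v : 'cV[R]_n) : R := \sum_i `|v i 0|.

Section TACo.
Variables (A : {set O}) (C : 'I_n -> O -> R) (b : 'I_n -> R) (gamma eps : R).

(* [selected t] is the option selected at step [t], and [tunit t] the trading
   unit in force at that step.  Steps are numbered from 0; in a run of [T]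
   steps the values from [T] on are irrelevant. *)
Record taco_trace := TacoTrace { selected : nat -> O; tunit : nat -> R }.

Definition in_turn (t : nat) (i : 'I_n) : bool := val i == (t %% n)%N.

Variable tr : taco_trace.

(* Ledgers before step [t], i.e. after the steps 0, ..., t - 1. *)
Fixpoint payment (t : nat) (i : 'I_n) (l : O) : R :=
  if t is s.+1 then
    payment s i l +
      (if in_turn s i && (selected tr s == l) then n%:R * tunit tr s else 0)
  else 0.

Fixpoint offer (t : nat) (j : 'I_n) (l : O) : R :=
  if t is s.+1 then
    offer s j l + (if selected tr s == l then tunit tr s else 0)
  else 0.

Definition profit (t : nat) (i : 'I_n) (l : O) : R :=
  b i * (offer t i l - payment t i l) - C i l.

(* The profits of some agent are the same at the steps [s] and [t]. *)
Definition cycle (s t : nat) : Prop :=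
  (s < t)%N /\ exists i, forall l, l \in A -> profit s i l = profit t i l.

Definition in_cycle (s t : nat) (l : O) : Prop :=
  exists2 k, (s <= k < t)%N & selected tr k = l.

(* The most recent choice of every agent is [l]: as the agents take turns
   cyclically, these are the choices of the last [n] steps. *)
Definition unanimous (t : nat) (l : O) : Prop :=
  (n <= t)%N /\ forall k, (t - n <= k < t)%N -> selected tr k = l.

(* The consensus declared in this case is an option of the cycle; which one is
   left open. *)
Definition within_tolerance (t : nat) (l : O) : Prop :=
  exists s, [/\ cycle s t, in_cycle s t l &
    forall j l1 l2, in_cycle s t l1 -> in_cycle s t l2 ->
      `|profit t j l1 - profit t j l2| < eps].

Definition consensus (t : nat) (l : O) : Prop :=
  unanimous t l \/ within_tolerance t l.

(* The run ends before step [T], with agreed option [l]. *)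
Definition taco_run (T : nat) (l : O) : Prop :=
  [/\ 0 < tunit tr 0,
      forall t, (t < T)%N ->
        forall i, in_turn t i -> selected tr t \in argmax_in A (profit t i),
      forall t, (t.+1 < T)%N ->
        ((exists s, cycle s t.+1) -> tunit tr t.+1 = gamma * tunit tr t) /\
        (~ (exists s, cycle s t.+1) -> tunit tr t.+1 = tunit tr t),
      forall t, (t < T)%N -> forall l', ~ consensus t l' &
      consensus T l].

End TACo.

Section Negotiation.
Variables (J : 'I_n -> O -> R) (rsv : 'I_n -> R) (kappa gamma eps : R).

Definition Jind (o : O) : 'cV[R]_n := \col_i J i o.

Definition Jsys (o : O) : R := \sum_i J i o.

(* The maxima range over nonnegative numbers, so the default value 0 is
   harmless. *)
Definition Brange (i : 'I_n) : R :=
  \big[Num.max/0]_(o : O) \big[Num.max/0]_(o' : O) `|J i o - J i o'|.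

Definition Bmax : R := \big[Num.max/0]_(i < n) Brange i.

Definition valuation (i : 'I_n) : R := 1 / (kappa * rsv i).

Definition score (v : 'cV[R]_n) (o : O) : R := (v^T *m Jind o) 0 0.

Definition alpha (w : 'cV[R]_n) : R := l1norm w + 1.

Definition wbar (w : 'cV[R]_n) : 'cV[R]_n := (alpha w)^-1 *: w.

Definition effective_cost (w : 'cV[R]_n) (i : 'I_n) (o : O) : R :=
  score (wbar w) o + 1 / alpha w * J i o.

Record round_data := RoundData {
  wfactor : 'cV[R]_n;         (* coordination factor *)
  proposal : 'I_n -> O;
  auction : taco_trace;
  stop : nat;                 (* number of steps of the auction *)
  outcome : O                 (* agreed option *)
}.

Definition proposals (d : round_data) : {set O} :=
  [set proposal d i | i : 'I_n].

Definition valid_round (d : round_data) : Prop :=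
  (forall i, proposal d i \in argmin (effective_cost (wfactor d) i)) /\
  taco_run (proposals d) (effective_cost (wfactor d)) valuation gamma eps
    (auction d) (stop d) (outcome d).

Definition net_expense (d : round_data) (i : 'I_n) : R :=
  payment (auction d) (stop d) i (outcome d)
    - offer (auction d) (stop d) i (outcome d).

Definition shortfall (d : round_data) (i : 'I_n) : R :=
  1 / rsv i * Num.max 0 (net_expense d i - rsv i).

Definition total_shortfall (d : round_data) : R := \sum_i shortfall d i.

(* The rounds 1, ..., r have been carried out (entry 0 of [N] is unused); in
   particular the process did not terminate before round [r]. *)
Definition negotiation (N : nat -> round_data) (r : nat) : Prop :=
  [/\ wfactor (N 1%N) = 0,
      forall k, (1 <= k <= r)%N -> valid_round (N k) &
      forall k, (1 <= k < r)%N ->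
        total_shortfall (N k) != 0 /\
        wfactor (N k.+1) =
          wfactor (N k) + \col_i (shortfall (N k) i / total_shortfall (N k))].

Definition uniform : 'cV[R]_n := const_mx (1 / n%:R).

Lemma Jsys_uniform (o : O) : (0 < n)%N -> Jsys o = n%:R * score uniform o.
Proof.
move=> n_gt0; rewrite /score mxE mulr_sumr; apply: eq_bigr => i _.
by rewrite !mxE mulrA mulrCA divff ?mulr1 ?mul1r // pnatr_eq0 -lt0n.
Qed.

End Negotiation.
End Framework.

(* Main.v *)
(* Moving the weights from [wbar] to the uniform vector changes a difference of
   scores by at most [Bmax * delta], which gives the first upper bound.  For
   the second one, the agreed option is the proposal of some agent [i]; since it
   minimizes [score + J i / alpha], its score exceeds the minimal score by at
   most [Bmax / alpha]. *)

Require Import Defs.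
From mathcomp Require Import all_boot all_order all_algebra.
From mathcomp Require Import reals.
Import Order.TTheory GRing.Theory Num.Theory.
Local Open Scope ring_scope.

Lemma argminP (R : realType) (O : finType) (f : O -> R) (o : O) :
  reflect (forall o', f o <= f o') (o \in argmin f).
Proof. by rewrite inE; exact: forallP. Qed.

Lemma dist_le_Bmax (R : realType) (n : nat) (O : finType) (J : 'I_n -> O -> R)
  (i : 'I_n) (o o' : O) : `|J i o - J i o'| <= Bmax J.
Proof.
apply: le_trans (le_bigmax _ (fun k => Brange J k) i).
apply: le_trans (le_bigmax _ _ o).
exact: (le_bigmax _ (fun o' => `|J i o - J i o'|) o').
Qed.

Lemma alpha_gt0 (R : realType) (n : nat) (w : 'cV[R]_n) : 0 < alpha w.
Proof. by rewrite ltr_wpDl// sumr_ge0. Qed.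

Lemma scoreE (R : realType) (n : nat) (O : finType) (J : 'I_n -> O -> R)
  (v : 'cV[R]_n) (o : O) : score J v o = \sum_i v i 0 * J i o.
Proof. by rewrite /score mxE; apply: eq_bigr => i _; rewrite !mxE. Qed.

(** Scores are linear in the weights, so the two differences differ by the sum of
    [(u i 0 - v i 0) * (J i o - J i o')], whose second factors are at most [Bmax J] in absolute
    value. *)
Lemma score_diff_le (R : realType) (n : nat) (O : finType) (J : 'I_n -> O -> R)
  (u v : 'cV[R]_n) (o o' : O) :
  score J u o - score J u o' <=
    Bmax J * l1norm (v - u) + (score J v o - score J v o').
Proof.
rewrite -lerBlDr !scoreE -!sumrB /l1norm mulr_sumr; apply: ler_sum => i _.
rewrite -!mulrBr -mulrBl !mxE (le_trans (ler_norm _))// normrM distrC mulrC.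
by rewrite ler_wpM2r// dist_le_Bmax.
Qed.

(** Either form of consensus declares an option that was selected at some earlier step, and agents
    select only within [A]. *)
Lemma taco_run_outcome (R : realType) (n : nat) (O : finType) (A : {set O})
  (C : 'I_n -> O -> R) (b : 'I_n -> R) (gamma eps : R) (tr : taco_trace R O)
  (T : nat) (l : O) :
  (0 < n)%N -> taco_run A C b gamma eps tr T l -> l \in A.
Proof.
move=> n_gt0 [_ sel _ _ cons].
have [k ltkT <-] : exists2 k, (k < T)%N & selected tr k = l.
  case: cons => [[lenT unan]|[s [_ [k /andP[_ ltkT] selk] _]]]; last by exists k.
  have T_gt0 := leq_trans n_gt0 lenT.
  (* The last step lies in the window of the last [n] steps because [n] is positive. *)
  exists T.-1; first by rewrite prednK.
  by apply: unan; rewrite prednK// leqnn andbT -subn1 leq_sub2l.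
(* The agent in turn at step [k] is [k %% n]. *)
have := sel k ltkT (Ordinal (ltn_pmod k n_gt0)) (eqxx _).
by rewrite inE => /andP[].
Qed.

Lemma proposal_score_le (R : realType) (n : nat) (O : finType)
  (J : 'I_n -> O -> R) (w : 'cV[R]_n) (i : 'I_n) (o o' : O) :
  o \in argmin (effective_cost J w i) ->
  score J (wbar w) o - score J (wbar w) o' <= Bmax J / alpha w.
Proof.
(* Optimality against [o'] bounds the score difference by [(alpha w)^-1 * (J i o' - J i o)]. *)
move=> /argminP /(_ o'); rewrite /effective_cost !mul1r -lerBrDr -addrA.
rewrite -mulrBr addrC -lerBlDr => /le_trans; apply.
rewrite mulrC ler_wpM2r ?invr_ge0 ?(ltW (alpha_gt0 _ _ w))//.
by apply: le_trans (ler_norm _) _; exact: dist_le_Bmax.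
Qed.

Theorem lemma4 (R : realType) (n : nat) (O : finType) (J : 'I_n -> O -> R)
    (rsv : 'I_n -> R) (kappa gamma eps : R)
    (n_gt0 : (0 < n)%N) (rsv_gt0 : forall i, 0 < rsv i) (kappa_gt0 : 0 < kappa)
    (gamma01 : 0 < gamma < 1) (eps_gt0 : 0 < eps)
    (N : nat -> round_data R n O) (r : nat) (r_ge1 : (1 <= r)%N)
    (N_run : negotiation J rsv kappa gamma eps N r)
    (o_opt : O) (o_optP : o_opt \in argmin (Jsys J))
    (o_dag : O) (o_dagP : o_dag \in argmin (score J (wbar (wfactor (N r))))) :
  let w := wfactor (N r) in
  let o_taco := outcome (N r) in
  let delta := l1norm (wbar w - uniform R n) in
  let eta := score J (wbar w) o_taco - score J (wbar w) o_dag in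
  [/\ 0 <= Jsys J o_taco - Jsys J o_opt,
      Jsys J o_taco - Jsys J o_opt <= n%:R * (Bmax J * delta + eta) &
      n%:R * (Bmax J * delta + eta)
        <= n%:R * (Bmax J * delta + Bmax J / alpha w)].
Proof.
move=> w o_taco delta eta; move/argminP: o_optP => opt_min.
move/argminP: o_dagP => dag_min.
have n_ge0 : 0 <= n%:R :> R by [].
split; first by rewrite subr_ge0.
- rewrite !Jsys_uniform// -mulrBr ler_wpM2l//.
  apply: le_trans (score_diff_le _ _ _ _ _ (wbar w) _ _) _.
  (* Since [o_dag] minimizes the [wbar] score, putting it in place of [o_opt] only enlarges the gap,
     to [eta]. *)
  by rewrite !lerD2l lerN2.
- rewrite ler_wpM2l// lerD2l.
  have [_ valid _] := N_run.
  have [|prop_min run] := valid r; first by rewrite r_ge1 /=.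
  have := taco_run_outcome _ _ _ _ _ _ _ _ _ _ _ n_gt0 run.
  move=> /imsetP[i _ taco_i]; apply: (proposal_score_le _ _ _ _ _ i).
  by rewrite /o_taco taco_i; exact: prop_min.
Qed.
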